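(* With $w=\sqrt{(u+1)^2-4}$, $$\sum_{n\ge0}\Bigl(\sum_{\sigma\in\mathfrak S_{n+1}}u^{{\rm rda}(\sigma)}\alpha^{{\rm LRmin}(\sigma)-1}\beta^{{\rm RLmin}(\sigma)-1}\Bigr)\frac{t^n}{n!}=e^{\frac{(\beta-\alpha)(u-1)}{2}t}\left(\frac{w}{w\cosh\bigl(\frac{wt}{2}\bigr)-(1+u)\sinh\bigl(\frac{wt}{2}\bigr)}\right)^{\alpha+\beta}.$$
   Context: For $\sigma=\sigma_1\cdots\sigma_m\in\mathfrak S_m$: ${\rm rda}(\sigma)$ is the number of $i$ with $1<i\le m$ and $\sigma_{i-1}<\sigma_i<\sigma_{i+1}$ (convention $\sigma_{m+1}=+\infty$); ${\rm LRmin}(\sigma)$ is the number of $i$ with $\sigma_j>\sigma_i$ for all $j<i$; ${\rm RLmin}(\sigma)$ is the number of $i$ with $\sigma_j>\sigma_i$ for all $j>i$. Identity of formal power series in $t$; the bracketed base has constant term $1$, only even powers of $w$ occur, and $G^c:=\exp(c\log G)$. *)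

(* Defs.v *)
From HB Require Import structures.
From mathcomp Require Import all_boot all_order all_algebra all_fingroup.
Set Implicit Arguments. Unset Strict Implicit. Unset Printing Implicit Defensive.
Import Order.TTheory GRing.Theory Num.Theory.

Section Stats.
Variable m : nat.
Implicit Type s : {perm 'I_m}.

(* double ascents: positions i (1-indexed 1 < i <= m) with s_(i-1) < s_i < s_(i+1),
   convention s_(m+1) = +oo *)
Definition rda s : nat :=
  #|[set i : 'I_m | [exists j : 'I_m, (j.+1 == i :> nat) && (s j < s i)%N]
                 && [forall k : 'I_m, (k == i.+1 :> nat) ==> (s i < s k)%N]]|.

Definition LRmin s : nat :=
  #|[set i : 'I_m | [forall j : 'I_m, (j < i)%N ==> (s i < s j)%N]]|.

Definition RLmin s : nat :=
  #|[set i : 'I_m | [forall j : 'I_m, (i < j)%N ==> (s i < s j)%N]]|.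
End Stats.

Local Open Scope ring_scope.

Section Series.
Variable R : numFieldType.
Definition ser := nat -> R.

Definition sone : ser := fun n => (n == 0)%:R.
Definition smul (f g : ser) : ser := fun n => \sum_(i < n.+1) f i * g (n - i)%N.
Definition spow (f : ser) (k : nat) : ser := iter k (smul f) sone.

(* exp f for f with zero constant term *)
Definition sexp (f : ser) : ser :=
  fun n => \sum_(k < n.+1) spow f k n / (k`!)%:R.
(* log G for G with constant term 1: sum_{k>=1} (-1)^(k+1) (G-1)^k / k *)
Definition slog (G : ser) : ser :=
  fun n => \sum_(1 <= k < n.+1)
     (-1) ^+ k.+1 * spow (fun j => G j - sone j) k n / k%:R.
(* multiplicative inverse of G with constant term 1: sum_k (1-G)^k *)
Definition sinv (G : ser) : ser :=
  fun n => \sum_(k < n.+1) spow (fun j => sone j - G j) k n.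
Definition spowr (G : ser) (c : R) : ser := sexp (fun n => c * slog G n).

Definition sexpc (c : R) : ser := fun n => c ^+ n / (n`!)%:R.

(* cosh(w t/2) and sinh(w t/2)/w, expressed through w2 = w^2
   (only even powers of w occur) *)
Definition scosh_half (w2 : R) : ser :=
  fun n => if odd n then 0 else w2 ^+ n./2 / (2 ^+ n * (n`!)%:R).
Definition ssinh_half_over_w (w2 : R) : ser :=
  fun n => if odd n then w2 ^+ n./2 / (2 ^+ n * (n`!)%:R) else 0.
End Series.

Definition perm_gf (R : numFieldType) (u a b : R) (n : nat) : R :=
  \sum_(s : {perm 'I_n.+1})
     u ^+ rda s * a ^+ (LRmin s).-1 * b ^+ (RLmin s).-1.

(* the base  w / (w cosh(wt/2) - (1+u) sinh(wt/2))
   = 1 / (cosh(wt/2) - (1+u) sinh(wt/2)/w),  w^2 = (u+1)^2 - 4 *)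
Definition base_ser (R : numFieldType) (u : R) : ser R :=
  let w2 := (u + 1) ^+ 2 - 4 in
  sinv (fun n => scosh_half w2 n - (1 + u) * ssinh_half_over_w w2 n).

(* Main.v *)
(** Cut a permutation at its minimum: both factors carry the same statistics, up
    to whether the neighbours of the factor count as smaller or larger.  Hence the
    exponential generating functions satisfy [P = A B], [A' = a A C],
    [B' = b (C + u - 1) B] and the Riccati equation [C' = C^2 + (u - 1) (C - 1)],
    where [C] counts double ascents of words preceded and followed by a smaller
    letter.  The Riccati equation is linearised by the denominator [F] of the base:
    [(log (1 / F))' = C + (u - 1) / 2].  Both sides of the theorem then solve the
    same first-order linear differential equation. *)

Require Import Defs.
From HB Require Import structures.
From mathcomp Require Import all_boot all_order all_algebra all_fingroup.
From mathcomp Require Import boolp ring zify.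
Set Implicit Arguments. Unset Strict Implicit. Unset Printing Implicit Defensive.
Import Order.TTheory GRing.Theory Num.Theory.
Local Open Scope ring_scope.

(** * Formal power series *)

Section SeriesRing.
Variable R : numFieldType.
Implicit Types f g h : ser R.

Definition sadd f g : ser R := fun n => f n + g n.
Definition sopp f : ser R := fun n => - f n.
Definition szero : ser R := fun=> 0.

(** Coefficient [n] of a product only sees coefficients up to [n], so commutativity and
    associativity are inherited from polynomial truncations. *)
Lemma smul_coef f g (p q : {poly R}) n :
  (forall i, (i <= n)%N -> f i = p`_i) -> (forall i, (i <= n)%N -> g i = q`_i) ->
  smul f g n = (p * q)`_n.
Proof.
move=> fp gq; rewrite coefM; apply: eq_bigr => i _.
by rewrite fp ?gq ?leq_subr // -ltnS.
Qed.

Lemma coef_trunc f n i : (i <= n)%N -> f i = (\poly_(j < n.+1) f j)`_i.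
Proof. by move=> le_in; rewrite coef_poly ltnS le_in. Qed.

Lemma smulC : commutative (@smul R).
Proof.
move=> f g; apply/funext => n.
by rewrite !(smul_coef (@coef_trunc _ n) (@coef_trunc _ n)) mulrC.
Qed.

Lemma smulA : associative (@smul R).
Proof.
move=> f g h; apply/funext => n.
have trM f1 f2 i : (i <= n)%N ->
    smul f1 f2 i = (\poly_(j < n.+1) f1 j * \poly_(j < n.+1) f2 j)`_i.
  move=> le_in; apply: smul_coef => j le_ji; apply: coef_trunc;
  exact: leq_trans le_in.
rewrite (smul_coef (@coef_trunc f n) (trM g h)) mulrA.
by rewrite (smul_coef (trM f g) (@coef_trunc h n)).
Qed.

Lemma smul1 : left_id (@sone R) (@smul R).
Proof.
move=> f; apply/funext => n; rewrite /smul big_ord_recl subn0 mul1r.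
by rewrite big1 ?addr0 // => i _; rewrite mul0r.
Qed.

Lemma smulDl : left_distributive (@smul R) sadd.
Proof.
move=> f g h; apply/funext => n; rewrite /sadd /smul -big_split.
by apply: eq_bigr => i _; rewrite mulrDl.
Qed.

Lemma saddA : associative sadd.
Proof. by move=> f g h; apply/funext => n; rewrite /sadd addrA. Qed.
Lemma saddC : commutative sadd.
Proof. by move=> f g; apply/funext => n; rewrite /sadd addrC. Qed.
Lemma sadd0 : left_id szero sadd.
Proof. by move=> f; apply/funext => n; rewrite /sadd add0r. Qed.
Lemma saddN : left_inverse szero sopp sadd.
Proof. by move=> f; apply/funext => n; rewrite /sadd addNr. Qed.
Lemma sone_neq0 : @sone R != szero.
Proof.
by apply/eqP => /(congr1 (@^~ 0%N)) /eqP; rewrite /sone oner_eq0.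
Qed.

HB.instance Definition _ := Choice.copy (ser R) (nat -> R).
HB.instance Definition _ := GRing.isZmodule.Build (ser R) saddA saddC sadd0 saddN.
HB.instance Definition _ :=
  GRing.Zmodule_isComNzRing.Build (ser R) smulA smulC smul1 smulDl sone_neq0.

Lemma serM f g n : (f * g) n = \sum_(i < n.+1) f i * g (n - i)%N.
Proof. by []. Qed.
Lemma ser1 n : (1 : ser R) n = (n == 0%N)%:R. Proof. by []. Qed.
Lemma serD f g n : (f + g) n = f n + g n. Proof. by []. Qed.
Lemma serN f n : (- f) n = - f n. Proof. by []. Qed.
Lemma serB f g n : (f - g) n = f n - g n. Proof. by []. Qed.

Lemma serMn f m n : (f *+ m) n = f n *+ m.
Proof. by elim: m => // m IHm; rewrite !mulrS serD IHm. Qed.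

Lemma spowE f k : spow f k = f ^+ k.
Proof. by elim: k => [|k IHk] //; rewrite exprS -IHk. Qed.

Definition sC (c : R) : ser R := fun n => c *+ (n == 0%N).

Lemma sCM c f n : (sC c * f) n = c * f n.
Proof.
rewrite serM big_ord_recl subn0 big1 ?addr0 // => i _.
by rewrite /sC mulr0n mul0r.
Qed.

Lemma sC_is_zmod_morphism : zmod_morphism sC.
Proof. by move=> c d; apply/funext => n; rewrite serB /sC mulrnBl. Qed.
Lemma sC_is_monoid_morphism : monoid_morphism sC.
Proof.
split=> [|c d]; apply/funext => n; first by [].
by rewrite sCM /sC mulrnAr.
Qed.
HB.instance Definition _ := GRing.isZmodMorphism.Build R (ser R) sC sC_is_zmod_morphism.
HB.instance Definition _ :=
  GRing.isMonoidMorphism.Build R (ser R) sC sC_is_monoid_morphism.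

(** * Formal derivative and linear differential equations *)

Definition sder f : ser R := fun n => f n.+1 *+ n.+1.

Lemma sder_is_zmod_morphism : zmod_morphism sder.
Proof. by move=> f g; apply/funext => n; rewrite serB /sder -mulrnBl. Qed.
HB.instance Definition _ :=
  GRing.isZmodMorphism.Build (ser R) (ser R) sder sder_is_zmod_morphism.

Lemma sderM f g : sder (f * g) = sder f * g + f * sder g.
Proof.
apply/funext => n; rewrite serD !serM /sder serM -sumrMnl.
(* The weight [n.+1] is split as [i + (n.+1 - i)]; each half then loses one boundary term. *)
transitivity (\sum_(i < n.+2) (f i *+ i * g (n.+1 - i)%N
                            + f i * (g (n.+1 - i)%N *+ (n.+1 - i)))).
  apply: eq_bigr => i _; rewrite mulrnAl mulrnAr -mulrnDr subnKC //.
  by rewrite -ltnS.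
rewrite big_split [X in X + _ = _]big_ord_recl /= mulr0n mul0r add0r.
congr (_ + _); rewrite big_ord_recr /= subnn mulr0n mulr0 addr0.
by apply: eq_bigr => i _; rewrite /= subSn // -ltnS.
Qed.

Lemma sderC c : sder (sC c) = 0.
Proof. by apply/funext => n; rewrite /sder /sC mulr0n mul0rn. Qed.

Lemma sder1 : sder 1 = 0.
Proof. by rewrite -(rmorph1 sC) sderC. Qed.

Lemma sderX f k : sder (f ^+ k.+1) = (f ^+ k * sder f) *+ k.+1.
Proof.
elim: k => [|k IHk]; first by rewrite expr1 mul1r.
by rewrite exprS sderM IHk mulrnAr mulrA -exprS [sder f * _]mulrC -mulrS.
Qed.

(** The equation determines coefficient [n.+1] of [f] from the earlier ones, [n.+1] being nonzero in
    [R]. *)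
Lemma linear_ode_eq0 f g : f 0%N = 0 -> sder f = g * f -> f = 0.
Proof.
move=> f0 df; apply/funext; elim/ltn_ind => -[_ //|n IHn].
have /eqP := congr1 (@^~ n) df; rewrite /sder serM big1 => [|i _].
  by rewrite mulrn_eq0 => /eqP.
by rewrite IHn ?mulr0 // ltnS leq_subr.
Qed.

Lemma linear_ode_uniq f1 f2 g : f1 0%N = f2 0%N ->
  sder f1 = g * f1 -> sder f2 = g * f2 -> f1 = f2.
Proof.
move=> f12 d1 d2; apply/eqP; rewrite -subr_eq0; apply/eqP.
by apply: (@linear_ode_eq0 _ g); rewrite ?serB ?f12 ?subrr // raddfB /= mulrBr d1 d2.
Qed.

(** * Substitution into a power series: exponential, inverse, logarithm *)

Lemma serX_lt f k n : f 0%N = 0 -> (n < k)%N -> (f ^+ k) n = 0.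
Proof.
move=> f0; elim: k n => // k IHk n lt_nk; rewrite exprS serM big_ord_recl f0 mul0r.
by rewrite add0r big1 // => i _; rewrite IHk ?mulr0 //= /bump; have := ltn_ord i; lia.
Qed.

(** Common form of [sexp], [slog] and [sinv]: [f] substituted into the series with coefficients [c].
    Stopping at [k = n] loses nothing when [f] has no constant term. *)
Definition scomp (c : nat -> R) f : ser R :=
  fun n => \sum_(k < n.+1) c k * (f ^+ k) n.

Lemma scomp_widen c f n m : f 0%N = 0 -> (n < m)%N ->
  scomp c f n = \sum_(k < m) c k * (f ^+ k) n.
Proof.
move=> f0 lt_nm; rewrite /scomp (big_ord_widen m (fun k => c k * (f ^+ k) n) lt_nm).
rewrite big_mkcond; apply: eq_bigr => k _; case: ltnP => // lt_nk.
by rewrite serX_lt ?mulr0.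
Qed.

Lemma scomp0 c f : scomp c f 0%N = c 0%N.
Proof. by rewrite /scomp big_ord1 expr0 ser1 mulr1. Qed.

Lemma eq_scomp c d f : c =1 d -> scomp c f = scomp d f.
Proof. by move=> cd; apply/funext => n; apply: eq_bigr => k _; rewrite cd. Qed.

Lemma scompM c f g n : f 0%N = 0 ->
  (scomp c f * g) n = \sum_(k < n.+1) c k * (f ^+ k * g) n.
Proof.
move=> f0; under [RHS]eq_bigr do rewrite serM mulr_sumr.
rewrite exchange_big serM; apply: eq_bigr => i _ /=.
rewrite (@scomp_widen c f i n.+1) // mulr_suml.
by apply: eq_bigr => k _; rewrite mulrA.
Qed.

(** Horner's rule, the source of the geometric series identities for [sinv] and [slog]. *)
Lemma scompS c f : f 0%N = 0 ->
  scomp c f = sC (c 0%N) + scomp (fun k => c k.+1) f * f.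
Proof.
move=> f0; apply/funext => n; rewrite (@scomp_widen _ _ _ n.+2) // big_ord_recl.
rewrite serD scompM // expr0 ser1 /sC mulr_natr; congr (_ + _).
by apply: eq_bigr => k _; rewrite -exprSr.
Qed.

Lemma sder_scomp c f : f 0%N = 0 ->
  sder (scomp c f) = scomp (fun k => c k.+1 *+ k.+1) f * sder f.
Proof.
move=> f0; apply/funext => n; rewrite scompM // /sder /scomp big_ord_recl.
rewrite expr0 ser1 mulr0 add0r -sumrMnl; apply: eq_bigr => k _.
rewrite -mulrnAr -/(sder (f ^+ k.+1) n) sderX.
by rewrite serMn mulrnAr mulrnAl.
Qed.

Lemma sexpE f : sexp f = scomp (fun k => (k`!%:R)^-1) f.
Proof. by apply/funext => n; apply: eq_bigr => k _; rewrite spowE mulrC. Qed.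

Lemma sinvE g : sinv g = scomp (fun=> 1) (1 - g).
Proof. by apply/funext => n; apply: eq_bigr => k _; rewrite spowE mul1r. Qed.

Lemma slogE g : slog g = scomp (fun k => (-1) ^+ k.+1 / k%:R) (g - 1).
Proof.
(* The term [k = 0], absent from [slog], vanishes because [0^-1 = 0]. *)
apply/funext => n; rewrite /slog /scomp big_ord_recl invr0 mulr0 mul0r add0r.
rewrite big_add1 big_mkord.
by apply: eq_bigr => k _; rewrite spowE mulrAC.
Qed.

Lemma sexp0 f : sexp f 0%N = 1.
Proof. by rewrite sexpE scomp0 invr1. Qed.

Lemma sinv0 g : sinv g 0%N = 1.
Proof. by rewrite sinvE scomp0. Qed.

Lemma slog0 g : slog g 0%N = 0.
Proof. by rewrite slogE scomp0 invr0 mulr0. Qed.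

Lemma sder_sexp f : f 0%N = 0 -> sder (sexp f) = sexp f * sder f.
Proof.
move=> f0; rewrite sexpE sder_scomp //; congr (_ * _); apply: eq_scomp => k.
by rewrite factS natrM invfM -mulrnAl -[_^-1 *+ _]mulr_natr mulVf ?mul1r ?pnatr_eq0.
Qed.

(** The geometric series [S = sinv g] satisfies [S = 1 + S (1 - g)]. *)
Lemma mul_sinv g : g 0%N = 1 -> g * sinv g = 1.
Proof.
move=> g0; have /(_ (1 - g)) := @scompS (fun=> 1).
rewrite serB g0 ser1 subrr -sinvE => /(_ erefl); rewrite rmorph1 => eq_s.
by rewrite mulrC -[g in _ * g](subKr 1) mulrBr mulr1 {1}eq_s addrK.
Qed.

(** With [h = g - 1], differentiating the logarithm leaves the alternating geometric series
    [S = 1 - S h], whence [S g = 1]. *)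
Lemma sder_slog g : g 0%N = 1 -> sder (slog g) * g = sder g.
Proof.
move=> g0; have h0 : (g - 1) 0%N = 0 by rewrite serB g0 subrr.
rewrite slogE sder_scomp // raddfB /= sder1 subr0.
set c := fun k : nat => _; rewrite mulrAC; suff -> : scomp c (g - 1) * g = 1.
  by rewrite mul1r.
have cE k : c k = (-1) ^+ k.
  by rewrite /c 2!exprS mulrA mulrNN !mul1r -[LHS]mulr_natr mulfVK // pnatr_eq0.
have eq_s : scomp c (g - 1) = 1 - scomp c (g - 1) * (g - 1).
  rewrite {1}scompS // cE rmorph1 -mulNr; congr (_ + _ * _).
  apply/funext => n; rewrite serN /scomp -sumrN; apply: eq_bigr => k _.
  by rewrite !cE exprS !mulNr mul1r.
by rewrite -{2}(subrK 1 g) mulrDr mulr1 {2}eq_s addrC subrK.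
Qed.

End SeriesRing.

(** * The closed form *)

Section ClosedForm.
Variable R : numFieldType.

Lemma sexpc0 (c : R) : sexpc c 0%N = 1.
Proof. by rewrite /sexpc expr0 invr1 mulr1. Qed.

Lemma sder_sexpc (c : R) : sder (sexpc c) = sC c * sexpc c.
Proof.
apply/funext => n; rewrite sCM /sder /sexpc factS natrM exprS.
by field; rewrite ?nat1r !pnatr_eq0 -lt0n fact_gt0.
Qed.

(** The chain rule gives [w / 2]; a second [w] comes from writing [sinh] as [w] times [sinh / w]. *)
Lemma sder_scosh_half (w2 : R) :
  sder (scosh_half w2) = sC (w2 / 2) * ssinh_half_over_w w2.
Proof.
apply/funext => n; rewrite sCM /sder /scosh_half /ssinh_half_over_w /=.
case: ifPn => [/negPf->|/negPn odd_n]; first by rewrite mulr0 mul0rn.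
rewrite odd_n uphalf_half odd_n factS natrM !exprS.
by field; rewrite ?nat1r !pnatr_eq0 expf_neq0 ?pnatr_eq0 // -lt0n fact_gt0.
Qed.

Lemma sder_ssinh_half_over_w (w2 : R) :
  sder (ssinh_half_over_w w2) = sC (2^-1) * scosh_half w2.
Proof.
apply/funext => n; rewrite sCM /sder /scosh_half /ssinh_half_over_w /=.
case: ifPn => [/negPf odd_n|/negPn->]; last by rewrite mulr0 mul0rn.
rewrite odd_n uphalf_half odd_n factS natrM !exprS.
by field; rewrite ?nat1r !pnatr_eq0 expf_neq0 ?pnatr_eq0 // -lt0n fact_gt0.
Qed.

Definition base_den (u : R) : ser R :=
  let w2 := (u + 1) ^+ 2 - 4 in
  scosh_half w2 - sC (1 + u) * ssinh_half_over_w w2.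

Lemma base_serE u : base_ser u = sinv (base_den u).
Proof. by congr sinv; apply/funext => n; rewrite /base_den serB sCM. Qed.

Lemma base_den0 u : base_den u 0%N = 1.
Proof.
rewrite /base_den serB sCM /scosh_half /ssinh_half_over_w /=.
by rewrite mulr0 subr0 mulr1 invr1 expr0 mulr1.
Qed.

(* [C + (u - 1) / 2] solves the Riccati equation [y' = y^2 - w^2 / 4] that
   [- F' / F] solves, [F] being the denominator of the base. *)
Lemma sder_slog_base (u : R) (C : ser R) :
  C 0%N = 1 -> sder C = C * C + sC (u - 1) * (C - 1) ->
  sder (slog (base_ser u)) = C + sC ((u - 1) / 2).
Proof.
move=> C0 dC; rewrite base_serE; set F := base_den u.
have half_half c : sC c = sC (c / 2) + sC (c / 2) :> ser R.
  by rewrite -rmorphD; congr sC; field.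
have F0 : F 0%N = 1 by exact: base_den0.
have dF : sder F = sC (((u + 1) ^+ 2 - 4) / 2) * ssinh_half_over_w ((u + 1) ^+ 2 - 4)
   - sC ((1 + u) / 2) * scosh_half ((u + 1) ^+ 2 - 4).
  rewrite /F /base_den raddfB /= sderM sderC mul0r add0r sder_scosh_half.
  by rewrite sder_ssinh_half_over_w mulrA -rmorphM.
(* Both [cosh (w t / 2)] and [sinh (w t / 2) / w] are eigenvectors of the second derivative, with
   eigenvalue [w^2 / 4]. *)
have ddF : sder (sder F) = sC (((u + 1) ^+ 2 - 4) / 4) * F.
  rewrite dF raddfB /= !sderM !sderC !mul0r !add0r sder_scosh_half.
  rewrite sder_ssinh_half_over_w /F /base_den mulrBr !mulrA -!rmorphM.
  by congr (sC _ * _ - sC _ * _); field.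
set D := C + _.
(* The shift by [(u - 1) / 2] completes the square in the Riccati equation. *)
have dD : sder D = D * D - sC (((u + 1) ^+ 2 - 4) / 4).
  have -> : ((u + 1) ^+ 2 - 4) / 4 = ((u - 1) / 2) * ((u - 1) / 2) + (u - 1) :> R.
    by field.
  rewrite /D raddfD /= sderC addr0 dC [sC (_ * _ + _)]rmorphD rmorphM /=.
  by rewrite (half_half (u - 1)); ring.
(* [Y = D F + F'] satisfies [Y' = D Y], and its constant term is [(1 + u) / 2 - (1 + u) / 2]. *)
have DF : D * F + sder F = 0.
  apply: (@linear_ode_eq0 _ _ D); last first.
    by rewrite raddfD /= sderM ddF dD; ring.
  rewrite serD serM big_ord1 F0 /D serD C0 dF serB !sCM /sC.
  by rewrite /scosh_half /ssinh_half_over_w /= !expr0 fact0; field.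
(* Differentiating [F * sinv F = 1] gives [- F' / F] as logarithmic derivative of [sinv F], and this
   is [D]. *)
have /(congr1 (@sder R)) := mul_sinv F0.
rewrite sder1 sderM => dFi; have := sder_slog (sinv0 F).
move/(congr1 ( *%R F)); rewrite [F * (_ * _)]mulrCA mul_sinv // mulr1 => ->.
have -> : F * sder (sinv F) = - (sder F * sinv F).
  by apply/eqP; rewrite -addr_eq0 addrC dFi.
have -> : sder F = - (D * F) by apply/eqP; rewrite -addr_eq0 addrC DF.
by rewrite mulNr opprK -mulrA mul_sinv // mulr1.
Qed.

(** Both sides have constant term 1 and the same logarithmic derivative, so uniqueness for linear
    equations applies. *)
Lemma closed_form (u a b : R) (C P : ser R) :
  C 0%N = 1 -> sder C = C * C + sC (u - 1) * (C - 1) ->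
  P 0%N = 1 -> sder P = (sC (a + b) * C + sC (b * (u - 1))) * P ->
  P = smul (sexpc ((b - a) * (u - 1) / 2)) (spowr (base_ser u) (a + b)).
Proof.
move=> C0 dC P0 dP; rewrite -[smul _ _]/((_ : ser R) * _).
have eqL : (fun n => (a + b) * slog (base_ser u) n)
    = sC (a + b) * slog (base_ser u) by apply/funext => n; rewrite sCM.
rewrite /spowr eqL; apply: linear_ode_uniq dP _.
  by rewrite serM big_ord1 sexpc0 sexp0 mulr1.
have L0 : (sC (a + b) * slog (base_ser u)) 0%N = 0 by rewrite sCM slog0 mulr0.
rewrite sderM sder_sexpc sder_sexp // sderM sderC mul0r add0r.
rewrite (sder_slog_base C0 dC).
(* The rate of the exponential and [a + b] times the shift [(u - 1) / 2] add up to [b (u - 1)]. *)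
have -> : sC (b * (u - 1))
    = sC ((b - a) * (u - 1) / 2) + sC (a + b) * sC ((u - 1) / 2).
  by rewrite -rmorphM -rmorphD; congr sC; field.
ring.
Qed.

End ClosedForm.

(** * Decomposition at the minimum *)

Section Splits.
Variable T : eqType.
Implicit Types (e s : seq T) (p : seq T * seq T).

(** All ways of dealing the letters of [e] to a left and a right part. Each part keeps the order of
    [e], so parts of a sorted alphabet are sorted. *)
Fixpoint splits e : seq (seq T * seq T) :=
  if e is x :: e' then
    [seq (x :: p.1, p.2) | p <- splits e'] ++ [seq (p.1, x :: p.2) | p <- splits e']
  else [:: ([::], [::])].

Lemma splits_subseq e p : p \in splits e -> subseq p.1 e && subseq p.2 e.
Proof.
elim: e p => [|x e IHe] p; first by rewrite inE => /eqP->.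
rewrite mem_cat => /orP[] /mapP[q /IHe /andP[s1 s2] ->] /=; rewrite eqxx ?s1 ?s2 /=.
  exact: subseq_trans s2 (subseq_cons _ _).
by rewrite andbT; exact: subseq_trans s1 (subseq_cons _ _).
Qed.

Lemma splits_perm e p : p \in splits e -> perm_eq (p.1 ++ p.2) e.
Proof.
elim: e p => [|x e IHe] p; first by rewrite inE => /eqP->.
rewrite mem_cat => /orP[] /mapP[q /IHe qe ->] /=; first by rewrite perm_cons.
by rewrite (perm_catCA _ [:: x]) perm_cons.
Qed.

Lemma filter_splits (a : pred T) e :
  ([seq x <- e | a x], [seq x <- e | ~~ a x]) \in splits e.
Proof.
elim: e => [|x e IHe] /=; first by rewrite inE.
rewrite mem_cat; apply/orP; case: (a x); [left | right]; apply/mapP;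
by eexists; first exact: IHe.
Qed.

(** Without repeated letters the two parts are disjoint, so the letters on the left determine the
    split. *)
Lemma splits_filter e p : uniq e -> p \in splits e ->
  p = ([seq x <- e | x \in p.1], [seq x <- e | x \notin p.1]).
Proof.
move=> Ue pe; have /andP[s1 s2] := splits_subseq pe.
have /(subseq_uniqP Ue) e1 := s1; have /(subseq_uniqP Ue) e2 := s2.
have Up := splits_perm pe; have := Ue; rewrite -(perm_uniq Up) cat_uniq.
case/and3P=> _ /hasPn dis _; rewrite {1}[p]surjective_pairing {1}e1 {1}e2.
congr (_, _); apply: eq_in_filter => x.
rewrite -(perm_mem Up) mem_cat => xp; apply/idP/idP => [/dis //|].
by move/negPf=> x1; rewrite x1 in xp.
Qed.

Lemma splits_uniq e : uniq e -> uniq (splits e).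
Proof.
elim: e => //= x e IHe /andP[xe Ue]; have Us := IHe Ue.
rewrite cat_uniq !map_inj_uniq ?Us /=; last 2 first.
- by move=> [? ?] [? ?] [-> ->].
- by move=> [? ?] [? ?] [-> ->].
rewrite andbT; apply/hasPn => _ /mapP[p pe ->]; apply/mapP => -[q qe [p1 _]].
case/negP: xe; have /andP[/mem_subseq sub _] := splits_subseq pe.
by apply: sub; rewrite p1 inE eqxx.
Qed.

Lemma cat_cons_inj (m : T) s1 s2 t1 t2 : m \notin s1 -> m \notin t1 ->
  s1 ++ m :: s2 = t1 ++ m :: t2 -> s1 = t1 /\ s2 = t2.
Proof.
move=> ms mt eq_st; have sz : size s1 = size t1.
  have := congr1 (index m) eq_st.
  by rewrite !index_cat (negPf ms) (negPf mt) /= eqxx !addn0.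
by move/eqP: eq_st; rewrite eqseq_cat // => /andP[/eqP-> /eqP[->]].
Qed.

(** The cut is reversible: [m] occurs once, so it determines both factors, and the letters of the
    left factor determine the split. *)
Lemma perm_permutations_cons (m : T) e : m \notin e -> uniq e ->
  perm_eq (permutations (m :: e))
    [seq t.1 ++ m :: t.2 | p <- splits e,
       t <- [seq (s1, s2) | s1 <- permutations p.1, s2 <- permutations p.2]].
Proof.
move=> me Ue; have splitI p (t : seq T * seq T) : p \in splits e ->
    t \in [seq (s1, s2) | s1 <- permutations p.1, s2 <- permutations p.2] ->
    [/\ perm_eq t.1 p.1, perm_eq t.2 p.2 & m \notin t.1].
  move=> pe /allpairsP[[s1 s2] /= []]; rewrite !mem_permutations => s1p s2p ->.
  split=> //=; rewrite (perm_mem s1p); apply: contra me; apply: mem_subseq.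
  by have /andP[] := splits_subseq pe.
apply: uniq_perm; first exact: permutations_uniq.
  apply: allpairs_uniq_dep => [|p _|]; first exact: splits_uniq.
    by rewrite allpairs_uniq ?permutations_uniq // => -[? ?] [? ?] _ _ [-> ->].
  move=> _ _ /allpairsPdep[p [s [pe sp ->]]] /allpairsPdep[q [t [qe tq ->]]] /=.
  have [s1 s2 ms] := splitI _ _ pe sp; have [t1 t2 mt] := splitI _ _ qe tq.
  move=> eq_st; have [e1 e2] := cat_cons_inj ms mt eq_st.
  have -> : s = t by rewrite [s]surjective_pairing [t]surjective_pairing e1 e2.
  have -> // : p = q.
  rewrite (splits_filter Ue pe) (splits_filter Ue qe).
  congr (_, _); apply: eq_filter => x;
  by rewrite -(perm_mem s1) -(perm_mem t1) e1.
move=> s; rewrite mem_permutations; apply/idP/allpairsPdep => [se | [p [t []]]].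
  have ms : m \in s by rewrite (perm_mem se) inE eqxx.
  case/splitPr: ms se => s1 s2; rewrite (perm_catCA _ [:: m]) perm_cons => se.
  have := Ue; rewrite -(perm_uniq se) cat_uniq => /and3P[U1 /hasPn dis U2].
  exists ([seq x <- e | x \in s1], [seq x <- e | x \notin s1]), (s1, s2).
  split=> //=; first exact: filter_splits.
  apply/allpairsP; exists (s1, s2); split=> //=; rewrite mem_permutations;
    apply: uniq_perm; rewrite ?filter_uniq // => x;
    rewrite mem_filter -(perm_mem se) mem_cat.
    by case: (x \in s1).
  by have /= := dis x; case: (x \in s1); case: (x \in s2) => //= /(_ isT).
move=> pe /(splitI _ _ pe) [t1 t2 _] ->; rewrite (perm_catCA _ [:: m]) perm_cons.
by apply: perm_trans (splits_perm pe); exact: perm_cat.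
Qed.
End Splits.

(** * Statistics of words and their behaviour at the minimum *)

Section WordStatistics.
Local Open Scope nat_scope.
Implicit Types (l r : bool) (s pre : seq nat).

(** [x] is the letter being judged: [l] records an ascent into it, and it counts when an ascent also
    leaves it. *)
Fixpoint rda_from l r x s : nat :=
  if s is y :: s' then (l && (x < y)) + rda_from (x < y) r y s' else l && r.

(* [l] says whether the first letter is preceded by a smaller one, [r] whether
   the last letter is followed by a larger one. *)
Definition rda_word l r s : nat := if s is x :: s' then rda_from l r x s' else 0.

Fixpoint lrmin_from pre s : nat :=
  if s is x :: s' then all (ltn x) pre + lrmin_from (x :: pre) s' else 0.

Definition lrmin_word s : nat := lrmin_from [::] s.

Fixpoint rlmin_word s : nat :=
  if s is x :: s' then all (ltn x) s' + rlmin_word s' else 0.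

(** The minimum is a smaller right neighbour for [L] and a smaller left neighbour for [R]. A
    nonempty [L] puts a descent before it. *)
Lemma rda_word_min l r m L R : all (ltn m) L -> all (ltn m) R ->
  rda_word l r (L ++ m :: R)
  = rda_word l false L + [&& nilp L, l & ~~ nilp R || r] + rda_word true r R.
Proof.
move=> mL mR; case: L mL => [_|x L] /=.
  case: R mR => [_|y R /= /andP[-> _]]; last by rewrite andbT.
  by rewrite /= addn0.
elim: L x l => [|y L IHL] x l /andP[mx mL] /=; last first.
  by rewrite IHL // !addnA.
rewrite ltnNge (ltnW mx) /= !andbF /= !add0n.
by case: R mR => [|y R /= /andP[-> _]].
Qed.

Lemma lrmin_from_above pre m s : m \in pre -> all (ltn m) s -> lrmin_from pre s = 0.
Proof.
elim: s pre => //= x s IHs pre mp /andP[mx ms]; rewrite IHs ?inE ?mp ?orbT //.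
rewrite addn0; apply/eqP; rewrite eqb0; apply/allPn; exists m => //.
by rewrite -leqNgt ltnW.
Qed.

(** No letter after the minimum counts, and the letters of [L] keep their predecessors. *)
Lemma lrmin_word_min m L R : all (ltn m) L -> all (ltn m) R ->
  lrmin_word (L ++ m :: R) = (lrmin_word L).+1.
Proof.
(* For the induction, the empty prefix is generalised to one whose letters all exceed [m]. *)
move=> mL mR; rewrite /lrmin_word; have : all (ltn m) [::] by [].
elim: L mL [::] => [_|x L IHL /= /andP[mx mL]] pre mpre /=.
  by rewrite mpre (@lrmin_from_above _ m) // mem_head.
by rewrite IHL ?addnS //= mx.
Qed.

Lemma rlmin_word_min m L R : all (ltn m) L -> all (ltn m) R ->
  rlmin_word (L ++ m :: R) = (rlmin_word R).+1.
Proof.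
move=> mL mR; elim: L mL => [_|x L IHL /= /andP[mx mL]] /=; first by rewrite mR.
by rewrite IHL // all_cat /= [x < m]ltnNge (ltnW mx) andbF.
Qed.

(** Positional form, to be matched with the set defining [rda]; [l] and [r] replace the comparisons
    beyond the ends. *)
Lemma rda_from_sum l r x s : rda_from l r x s =
  \sum_(i < (size s).+1)
     ((if val i is j.+1 then nth 0 (x :: s) j < nth 0 s j else l)
      && (if i < size s then nth 0 (x :: s) i < nth 0 s i else r)).
Proof.
elim: s l x => [|y s IHs] l x; first by rewrite big_ord1.
rewrite big_ord_recl [LHS]/= IHs; congr (_ + _).
by apply: eq_bigr => -[[|i] lt_i] _.
Qed.

Lemma lrmin_word_sum s : lrmin_word s =
  \sum_(i < size s) all (ltn (nth 0 s i)) (take i s).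
Proof.
rewrite /lrmin_word.
transitivity (\sum_(i < size s) all (ltn (nth 0 s i)) ([::] ++ take i s)) => //.
elim: s [::] => [|x s IHs] pre; first by rewrite big_ord0.
rewrite big_ord_recl /= cats0 IHs; congr (_ + _); apply: eq_bigr => i _ /=.
by rewrite !all_cat /= andbCA.
Qed.

Lemma rlmin_word_sum s : rlmin_word s =
  \sum_(i < size s) all (ltn (nth 0 s i)) (drop i.+1 s).
Proof.
elim: s => [|x s IHs]; first by rewrite big_ord0.
by rewrite big_ord_recl /= drop0 IHs.
Qed.

End WordStatistics.

(** * Permutations in one-line notation *)

Section PermWord.
Variable m : nat.
Implicit Types (s : {perm 'I_m}) (i : 'I_m).

Definition perm_word s : seq nat := [seq val (s i) | i <- enum 'I_m].

Lemma size_perm_word s : size (perm_word s) = m.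
Proof. by rewrite size_map size_enum_ord. Qed.

Lemma nth_perm_word s i : nth 0%N (perm_word s) i = s i.
Proof. by rewrite (nth_map i) ?size_enum_ord // nth_ord_enum. Qed.

Lemma perm_word_inj : injective perm_word.
Proof.
move=> s t eq_st; apply/permP => i; apply: val_inj.
by rewrite /= -!nth_perm_word eq_st.
Qed.

(** Turns sums over the symmetric group into sums over words, which can be cut at a letter. *)
Lemma perm_perm_words :
  perm_eq [seq perm_word s | s <- index_enum {perm 'I_m}] (permutations (iota 0 m)).
Proof.
apply: uniq_perm; first by rewrite (map_inj_uniq perm_word_inj) index_enum_uniq.
  exact: permutations_uniq.
move=> w; rewrite mem_permutations; apply/mapP/idP => [[s _ ->] | w_perm].
  rewrite -val_enum_ord /perm_word map_comp; apply: perm_map.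
  apply: uniq_perm => [||i]; rewrite ?(map_inj_uniq perm_inj) ?enum_uniq //.
  rewrite mem_enum; apply/mapP; exists (s^-1%g i); rewrite ?mem_enum //.
  by rewrite permKV.
have sz_w : size w = m by rewrite (perm_size w_perm) size_iota.
have w_lt (i : 'I_m) : (nth 0%N w i < m)%N.
  have : nth 0%N w i \in iota 0 m by rewrite -(perm_mem w_perm) mem_nth ?sz_w.
  by rewrite mem_iota.
(* Distinct letters make the map from positions to letters injective, hence a permutation. *)
have w_inj : injective (fun i => Ordinal (w_lt i)).
  move=> i j [] /eqP; rewrite nth_uniq ?sz_w ?(perm_uniq w_perm) ?iota_uniq //.
  by move/eqP/val_inj.
exists (perm w_inj); first exact: mem_index_enum.
apply: (@eq_from_nth _ 0%N) => [|i]; first by rewrite size_perm_word.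
by rewrite sz_w => lt_im; rewrite (nth_perm_word _ (Ordinal lt_im)) permE.
Qed.

Lemma card_set_sum (P : pred 'I_m) : #|[set i | P i]| = (\sum_(i < m) P i)%N.
Proof. by rewrite cardsE -sum1_card big_mkcond. Qed.

(** [false] since the first position is excluded, [true] by the convention of a final [+oo]. *)
Lemma rda_perm_word s : rda s = rda_word false true (perm_word s).
Proof.
rewrite /rda card_set_sum.
transitivity (\sum_(i < m)
    ((if val i is j.+1 then nth 0 (perm_word s) j < nth 0 (perm_word s) i else false)
     && (if i.+1 < m then nth 0 (perm_word s) i < nth 0 (perm_word s) i.+1
         else true)))%N.
  apply: eq_bigr => i _; congr (nat_of_bool (_ && _)).
    case: i => -[|i] lt_im; first by apply/existsP => -[j].
    rewrite /= (nth_perm_word _ (Ordinal lt_im)).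
    rewrite (nth_perm_word _ (Ordinal (ltnW lt_im))).
    apply/existsP/idP => [[j /andP[/eqP[eq_ji]]] | lt_s].
      by rewrite (_ : j = Ordinal (ltnW lt_im)) //; apply: val_inj.
    by exists (Ordinal (ltnW lt_im)); rewrite eqxx.
  rewrite nth_perm_word; case: ifP => [lt_im | nlt_im].
    rewrite (nth_perm_word _ (Ordinal lt_im)).
    apply/forallP/idP => [/(_ (Ordinal lt_im)) | lt_s k]; first by rewrite eqxx.
    apply/implyP => /eqP eq_k; rewrite (_ : k = Ordinal lt_im) //.
    exact: val_inj.
  by apply/forallP => k; apply/implyP => /eqP eq_k; rewrite -eq_k ltn_ord in nlt_im.
have := size_perm_word s; case: (perm_word s) => [|x w] /= sz_w.
  by rewrite -sz_w big_ord0.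
rewrite rda_from_sum -sz_w; apply: eq_bigr => -[[|i] lt_i] _ //=.
Qed.

Lemma lrmin_perm_word s : LRmin s = lrmin_word (perm_word s).
Proof.
rewrite /LRmin card_set_sum lrmin_word_sum size_perm_word.
apply: eq_bigr => i _; congr (nat_of_bool _); rewrite nth_perm_word.
have sz_i : size (take i (perm_word s)) = i.
  by rewrite size_takel // size_perm_word ltnW.
apply/forallP/(all_nthP 0%N) => min_i j; last rewrite sz_i in min_i.
  rewrite sz_i => lt_ji; rewrite nth_take //.
  rewrite (nth_perm_word _ (Ordinal (ltn_trans lt_ji (ltn_ord i)))).
  exact: (implyP (min_i _)).
apply/implyP => lt_ji; have := min_i j; rewrite nth_take // nth_perm_word.
by apply.
Qed.

Lemma rlmin_perm_word s : RLmin s = rlmin_word (perm_word s).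
Proof.
rewrite /RLmin card_set_sum rlmin_word_sum size_perm_word.
apply: eq_bigr => i _; congr (nat_of_bool _); rewrite nth_perm_word.
apply/forallP/(all_nthP 0%N) => [min_i j | min_i j].
  rewrite size_drop size_perm_word nth_drop ltn_subRL => lt_jm.
  rewrite (nth_perm_word _ (Ordinal lt_jm)).
  by apply: (implyP (min_i _)); rewrite /= leq_addr.
apply/implyP => lt_ij; have := min_i (j - i.+1)%N.
rewrite size_drop size_perm_word nth_drop subnKC // nth_perm_word; apply.
by rewrite ltn_sub2r ?ltn_ord // (leq_ltn_trans lt_ij).
Qed.

End PermWord.

(** * Generating functions *)

Section ExponentialGF.
Variable R : numFieldType.
Implicit Types h : nat -> R.

Definition egf h : ser R := fun n => h n / n`!%:R.

Lemma sder_egf h : sder (egf h) = egf (fun n => h n.+1).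
Proof.
apply/funext => n; rewrite /sder /egf factS natrM.
by field; rewrite ?nat1r !pnatr_eq0 -lt0n fact_gt0.
Qed.

(** A new letter goes left or right, which shifts [h1] or [h2] and so differentiates one factor: the
    induction step is the Leibniz rule. *)
Lemma sum_splits (T : eqType) (e : seq T) h1 h2 :
  \sum_(p <- splits e) h1 (size p.1) * h2 (size p.2)
  = (size e)`!%:R * (egf h1 * egf h2) (size e).
Proof.
elim: e h1 h2 => [|x e IHe] h1 h2 /=.
  by rewrite big_seq1 serM big_ord1 /egf invr1 !mulr1 mul1r.
rewrite big_cat !big_map /= (IHe (fun n => h1 n.+1)) (IHe h1 (fun n => h2 n.+1)).
rewrite -!sder_egf -mulrDr -[X in _ * X]serD -sderM /sder factS natrM.
ring.
Qed.

End ExponentialGF.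

(** * Generating functions of words and their differential equations *)

Section WordGF.
Variables (R : numFieldType) (u : R).
Implicit Types (l r : bool) (x y : R) (e s : seq nat).

Definition word_weight l r x y s : R :=
  u ^+ rda_word l r s * x ^+ lrmin_word s * y ^+ rlmin_word s.

(** The alphabet [e] is arbitrary because the factors of a cut word use only some of the letters. *)
Definition word_sum l r x y e : R :=
  \sum_(s <- permutations e) word_weight l r x y s.

(** The series [A], [B], [C] of the overview are [word_gf false false a 1], [word_gf true true 1 b]
    and [word_gf true false 1 1]. *)
Definition word_gf l r x y : ser R :=
  egf (fun n => word_sum l r x y (iota 0 n)).

Lemma sum_permutations_cons (f : seq nat -> R) m e : m \notin e -> uniq e ->
  \sum_(s <- permutations (m :: e)) f s
  = \sum_(p <- splits e) \sum_(L <- permutations p.1) \sum_(S <- permutations p.2)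
      f (L ++ m :: S).
Proof.
move=> me Ue; rewrite (perm_big _ (perm_permutations_cons me Ue)) /=.
rewrite big_allpairs_dep; apply: eq_bigr => p _.
by rewrite big_allpairs_dep.
Qed.

(* The factor accounts for the minimum itself, which is a double ascent exactly
   when it comes first, after a smaller letter, and is followed by a larger one. *)
Lemma word_sum_min l r x y m e : path ltn m e ->
  word_sum l r x y (m :: e) = x * y * \sum_(p <- splits e)
    (if [&& size p.1 == 0%N, l & (size p.2 != 0%N) || r] then u else 1)
    * (word_sum l false x 1 p.1 * word_sum true r 1 y p.2).
Proof.
move=> me; have := path_sorted me; have /allP m_lt := order_path_min ltn_trans me.
move=> /(sorted_uniq ltn_trans ltnn) Ue.
rewrite /word_sum sum_permutations_cons //; last first.
  by apply/negP => /m_lt; rewrite ltnn.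
rewrite mulr_sumr big_seq [RHS]big_seq; apply: eq_bigr => p pe.
rewrite mulr_suml !mulr_sumr big_seq [RHS]big_seq; apply: eq_bigr => L.
rewrite mem_permutations => Lp.
rewrite !mulr_sumr big_seq [RHS]big_seq; apply: eq_bigr => S.
rewrite mem_permutations => Sp.
have /andP[/mem_subseq s1 /mem_subseq s2] := splits_subseq pe.
have mL : all (ltn m) L.
  by apply/allP => z; rewrite (perm_mem Lp) => /s1 /m_lt.
have mS : all (ltn m) S.
  by apply/allP => z; rewrite (perm_mem Sp) => /s2 /m_lt.
rewrite /word_weight rda_word_min // lrmin_word_min // rlmin_word_min //.
rewrite -(perm_size Lp) -(perm_size Sp) !expr1n !exprD !exprS.
rewrite /nilp; case: ifP => _; rewrite ?expr1 ?expr0; ring.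
Qed.

Lemma word_sum_nil l r x y : word_sum l r x y [::] = 1.
Proof. by rewrite /word_sum big_seq1 /word_weight !mulr1. Qed.

Lemma word_gf0 l r x y : word_gf l r x y 0%N = 1.
Proof. by rewrite /word_gf /egf word_sum_nil invr1 mulr1. Qed.

(** The factor is 1 plus a correction supported on empty left parts, so the sum becomes two products
    of series. *)
Lemma sum_splits_word (T : eqType) (e : seq T) l r x y :
  \sum_(p <- splits e) (if [&& size p.1 == 0%N, l & (size p.2 != 0%N) || r] then u else 1)
    * (word_sum l false x 1 (iota 0 (size p.1)) * word_sum true r 1 y (iota 0 (size p.2)))
  = (size e)`!%:R * (word_gf l false x 1 * word_gf true r 1 y
      + sC (if l then u - 1 else 0) * (word_gf true r 1 y - sC (~~ r)%:R)) (size e).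
Proof.
(* [d1] selects the empty left part; [d2] discards the empty right part unless [r] holds, which is
   the subtracted constant [(~~ r)%:R]. *)
pose d1 i : R := (if l then u - 1 else 0) * (i == 0%N)%:R.
pose d2 j : R :=
  if (j != 0%N) || r then word_sum true r 1 y (iota 0 j) else 0.
have -> : sC (if l then u - 1 else 0) = egf d1.
  apply/funext => -[|n]; rewrite /sC /egf /d1 /= ?invr1 ?mulr1 //.
  by rewrite mulr0 mul0r.
have -> : word_gf true r 1 y - sC (~~ r)%:R = egf d2.
  apply/funext => -[|n]; rewrite serB /sC /egf /d2 /=.
    rewrite word_gf0 invr1 mulr1 word_sum_nil; case: (r) => /=; rewrite ?subr0 //.
    by rewrite subrr.
  by rewrite subr0.
rewrite serD mulrDr -!sum_splits -big_split; apply: eq_bigr => p _ /=.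
rewrite /d1 /d2; case: eqP => [->|_] /=; last by rewrite mulr0 mul0r mul1r addr0.
rewrite word_sum_nil; case: (l) => /=; last by rewrite !mul0r !mul1r addr0.
by case: ifP => _; ring.
Qed.

(** Strong induction on the size: cutting at the minimum leaves smaller sorted alphabets, whose sums
    depend on their sizes only. *)
Lemma word_sum_size l r x y e : sorted ltn e ->
  word_sum l r x y e = word_sum l r x y (iota 0 (size e)).
Proof.
have [n] := ubnP (size e); elim: n e l r x y => // n IHn [|m e] // l r x y lt_e me.
(* Stated for every alphabet of this size, to serve both [m :: e] and the initial segment of the
   integers. *)
have rec m' e' : size e' = size e -> path ltn m' e' ->
    word_sum l r x y (m' :: e') = x * y * ((size e)`!%:R
      * (word_gf l false x 1 * word_gf true r 1 y
         + sC (if l then u - 1 else 0) * (word_gf true r 1 y - sC (~~ r)%:R)) (size e)).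
  move=> sz_e' me'; rewrite word_sum_min // -sz_e' -sum_splits_word.
  congr (_ * _); rewrite big_seq [RHS]big_seq; apply: eq_bigr => p pe'.
  have /andP[s1 s2] := splits_subseq pe'; have se' := path_sorted me'.
  rewrite -!IHn ?(subseq_sorted ltn_trans _ se') //.
    by rewrite (leq_ltn_trans (size_subseq s2)) // sz_e'.
  by rewrite (leq_ltn_trans (size_subseq s1)) // sz_e'.
rewrite rec // [iota _ _]/= rec ?size_iota //.
exact: (iota_ltn_sorted 0 (size e).+1).
Qed.

Lemma word_sum_rec l r x y m e : path ltn m e ->
  word_sum l r x y (m :: e) = x * y * ((size e)`!%:R
      * (word_gf l false x 1 * word_gf true r 1 y
         + sC (if l then u - 1 else 0) * (word_gf true r 1 y - sC (~~ r)%:R)) (size e)).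
Proof.
move=> me; rewrite word_sum_min // -sum_splits_word.
congr (_ * _); rewrite big_seq [RHS]big_seq; apply: eq_bigr => p pe.
have /andP[s1 s2] := splits_subseq pe; have se := path_sorted me.
by rewrite -!word_sum_size ?(subseq_sorted ltn_trans _ se).
Qed.

(** Differentiation shifts the size by one, turning the recursion at the minimum into a differential
    equation. Those for [A], [B] and [C] are special cases. *)
Lemma sder_word_gf l r x y :
  sder (word_gf l r x y) = sC (x * y) *
    (word_gf l false x 1 * word_gf true r 1 y
     + sC (if l then u - 1 else 0) * (word_gf true r 1 y - sC (~~ r)%:R)).
Proof.
rewrite {1}/word_gf sder_egf; apply/funext => n.
rewrite sCM /egf [iota _ _]/= word_sum_rec ?size_iota; last first.
  exact: (iota_ltn_sorted 0 n.+1).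
by rewrite -mulrA; congr (_ * _); rewrite mulrAC mulfV ?mul1r // pnatr_eq0 -lt0n fact_gt0.
Qed.

(** This is [P = A B]. The overall minimum counts once in [LRmin] and once in [RLmin], which the
    predecessors cancel, and is no double ascent as nothing smaller precedes it. *)
Lemma perm_gf_word a b n :
  perm_gf u a b n / n`!%:R = (word_gf false false a 1 * word_gf true true 1 b) n.
Proof.
have mu : path ltn 0%N (iota 1 n) by exact: (iota_ltn_sorted 0 n.+1).
transitivity ((\sum_(s <- permutations (0%N :: iota 1 n))
  u ^+ rda_word false true s * a ^+ (lrmin_word s).-1 * b ^+ (rlmin_word s).-1) / n`!%:R).
  congr (_ / _); rewrite -(perm_big _ (perm_perm_words n.+1)) big_map /perm_gf.
  by apply: eq_bigr => s _; rewrite rda_perm_word lrmin_perm_word rlmin_perm_word.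
have := order_path_min ltn_trans mu => /allP m_lt.
rewrite sum_permutations_cons ?iota_uniq ?mem_iota //.
have nz : n`!%:R != 0 :> R by rewrite pnatr_eq0 -lt0n fact_gt0.
apply: (canLR (mulfK nz)); rewrite mulrC.
have := sum_splits (iota 1 n) (fun n => word_sum false false a 1 (iota 0 n))
  (fun n => word_sum true true 1 b (iota 0 n)).
rewrite size_iota => <-; rewrite big_seq [RHS]big_seq; apply: eq_bigr => p pe.
have /andP[s1 s2] := splits_subseq pe; have se := path_sorted mu.
rewrite -!word_sum_size ?(subseq_sorted ltn_trans _ se) // /word_sum.
move: s1 s2 => /mem_subseq s1 /mem_subseq s2.
rewrite mulr_suml big_seq [RHS]big_seq; apply: eq_bigr => L.
rewrite mem_permutations => Lp.
rewrite mulr_sumr big_seq [RHS]big_seq; apply: eq_bigr => S.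
rewrite mem_permutations => Sp.
have mL : all (ltn 0%N) L by apply/allP => z; rewrite (perm_mem Lp) => /s1 /m_lt.
have mS : all (ltn 0%N) S by apply/allP => z; rewrite (perm_mem Sp) => /s2 /m_lt.
rewrite rda_word_min // lrmin_word_min // rlmin_word_min // andbF addn0 /=.
by rewrite /word_weight !expr1n !exprD; ring.
Qed.

End WordGF.

Theorem theorem4p6 (R : numFieldType) (u a b : R) (n : nat) :
  perm_gf u a b n / (n`!)%:R =
  smul (sexpc ((b - a) * (u - 1) / 2))
       (spowr (base_ser u) (a + b)) n.
Proof.
rewrite perm_gf_word; congr (_ n).
apply: (@closed_form _ u a b (word_gf u true false 1 1)).
- exact: word_gf0.
- by rewrite sder_word_gf mulr1 rmorph1 mul1r.
- by rewrite serM big_ord1 !word_gf0 mulr1.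
(* The product rule gives [A' B + A B' = (a C + b (C + u - 1)) A B]. *)
rewrite sderM !sder_word_gf /= !rmorph0 !mulr1 !mul1r rmorphD rmorphM /=.
ring.
Qed.
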